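(* Let $n\geq 2$ be an integer. Then $\gamma(C_n^*,r)=2n$ for every $r\in\left(1-\frac1n,1\right]$. Additionally, $\left(1-\frac1n,1\right]$ is the largest possible interval with this property: if $I\subseteq(0,\infty)$ is any interval such that $\gamma(C_n^*,r)=2n$ for all $r\in I$, then $I\subseteq\left(1-\frac1n,1\right]$.
   Context: $C_n^*=\{\mathbf{x}\in\mathbb{R}^n : \sum_{i=1}^n|x_i|\leq 1\}$ is the unit cross-polytope and $\|\cdot\|_1$ is the $l_1$-norm on $\mathbb{R}^n$. For $r>0$, $\gamma(C_n^*,r):=\max\{|D| : D\subset C_n^*\text{ and }\|\mathbf{x}-\mathbf{y}\|_1\geq 2r\text{ for all }\mathbf{x},\mathbf{y}\in D,\ \mathbf{x}\neq\mathbf{y}\}$, where $|D|$ denotes the cardinality of $D$. *)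

(* Defs.v *)
From HB Require Import structures.
From mathcomp Require Import all_boot all_order all_algebra.
From mathcomp Require Import all_classical all_reals all_analysis.

Set Implicit Arguments.
Unset Strict Implicit.
Unset Printing Implicit Defensive.
Import Order.TTheory GRing.Theory Num.Theory.
Local Open Scope classical_set_scope.
Local Open Scope ring_scope.
Local Open Scope card_scope.

(* The library norm on ['rV[R]_n] is the sup norm, hence a separate l1-norm. *)
Definition l1norm (R : realType) (n : nat) (x : 'rV[R]_n) : R :=
  \sum_(i < n) `|x 0 i|.

Definition cross_polytope (R : realType) (n : nat) : set 'rV[R]_n :=
  [set x | l1norm x <= 1].
Arguments cross_polytope : clear implicits.

Definition is_packing (R : realType) (n : nat) (K : set 'rV[R]_n) (r : R)
    (D : set 'rV[R]_n) : Prop :=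
  D `<=` K /\
  forall x y, D x -> D y -> x <> y -> 2 * r <= l1norm (x - y).

(* [D] ranges over arbitrary sets, so infinite packings rule out a maximum. *)
Definition is_max_packing_card (R : realType) (n : nat) (K : set 'rV[R]_n)
    (r : R) (m : nat) : Prop :=
  (exists2 D, is_packing K r D & D #= `I_m) /\
  (forall D, is_packing K r D -> D #<= `I_m).

(* The value is 0 by default if there is no maximum (e.g. K unbounded convex);
   for K bounded and r > 0 the maximum exists, and it is positive unless K is
   empty. *)
Definition gamma (R : realType) (n : nat) (K : set 'rV[R]_n) (r : R) : nat :=
  xget 0%N [set m | is_max_packing_card K r m].

Lemma gamma_eq (R : realType) (n : nat) (K : set 'rV[R]_n) (r : R) (m : nat) :
  (0 < m)%N -> gamma K r = m <-> is_max_packing_card K r m.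
Proof.
rewrite /gamma => m0; split=> [m_eq | maxm].
  move: m_eq; case: xgetP => [k -> maxk <- // | _ m_eq0].
  by rewrite -m_eq0 in m0.
apply: xget_unique => // k [[D' D'K D'k] ubk].
case: maxm => -[D DK Dm] ubm.
apply/eqP; rewrite eqn_leq -!card_le_II; apply/andP; split.
- by rewrite -(card_le_eql D'k); exact: ubm.
- by rewrite -(card_le_eql Dm); exact: ubk.
Qed.

(* Main.v *)
Require Import Defs.
From HB Require Import structures.
From mathcomp Require Import all_boot all_order all_algebra.
From mathcomp Require Import all_classical all_reals all_analysis.
From mathcomp Require Import lra.

Set Implicit Arguments.
Unset Strict Implicit.
Unset Printing Implicit Defensive.
Import Order.TTheory GRing.Theory Num.Theory.
Local Open Scope classical_set_scope.
Local Open Scope ring_scope.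

(* Upper bound: every x has a coordinate with n |x_i| >= |x|_1. If two points
   share such an index i together with the sign of the coordinate there, the
   cancellation at i forces |x - y|_1 <= 2 - 2/n < 2r; hence a packing injects
   into the 2n pairs (index, sign). The vertices attain the bound when r <= 1.
   For r <= 1 - 1/n the point (1/n, ..., 1/n) can be added to the vertices, and
   for r > 1 any packing has at most one point, the diameter being 2. *)

Lemma card_setT_II (T : finType) : ([set: T] #= `I_#|T|)%card.
Proof.
apply: card_esym; apply: (card_eq_trans card_II).
suff <- : @enum_rank T @` setT = setT.
  by apply: inj_card_eq => x y _ _; exact: enum_rank_inj.
by apply/seteqP; split=> // i _; exists (enum_val i) => //; rewrite enum_valK.
Qed.

(** Pigeonhole: distinct points of [D] with the same label under [f] would be too close, so [f] is
    injective on [D]. *)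
Lemma packing_card_le (R : realType) (n : nat) (K : set 'rV[R]_n) (r : R)
    (D : set 'rV[R]_n) (T : finType) (f : 'rV[R]_n -> T) :
  is_packing K r D ->
  (forall x y, K x -> K y -> f x = f y -> l1norm (x - y) < 2 * r) ->
  (D #<= `I_#|T|)%card.
Proof.
move=> [DK Dr] fP; rewrite -(card_le_eqr (card_setT_II T)).
have f_inj : {in D &, injective f}.
  move=> x y /set_mem Dx /set_mem Dy fxy; apply: contrapT => xy.
  by have := fP _ _ (DK _ Dx) (DK _ Dy) fxy; rewrite ltNge Dr.
by rewrite -(card_le_eql (inj_card_eq f_inj)); exact: card_leT.
Qed.

(** As [0 < r], separation already makes [g] injective: equal images would be at distance 0. *)
Lemma packing_range (R : realType) (n : nat) (K : set 'rV[R]_n) (r : R)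
    (T : finType) (g : T -> 'rV[R]_n) :
  0 < r -> (forall t, K (g t)) ->
  (forall s t, s != t -> 2 * r <= l1norm (g s - g t)) ->
  is_packing K r (range g) /\ (range g #= `I_#|T|)%card.
Proof.
move=> r0 gK gr; split.
  split=> [_ [t _ <-] //|_ _ [s _ <-] [t _ <-] gst].
  by apply: gr; apply: contra_notN gst => /eqP ->.
apply: card_eq_trans (card_setT_II T); apply: inj_card_eq => s t _ _ gst.
apply/eqP; apply/negPn/negP => /gr; rewrite gst subrr /l1norm.
by rewrite big1 => [|i _]; [lra | rewrite mxE normr0].
Qed.

Section L1norm.
Variables (R : realType) (n : nat).
Implicit Types x y : 'rV[R]_n.

Lemma l1normB_le x y : l1norm (x - y) <= l1norm x + l1norm y.
Proof.
rewrite -big_split; apply: ler_sum => i _; rewrite !mxE; exact: ler_normB.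
Qed.

Lemma norm_coord_le_l1norm x i : `|x 0 i| <= l1norm x.
Proof. by rewrite /l1norm (bigD1 i) //= lerDl sumr_ge0. Qed.

Lemma norm_coord2_le_l1norm x i j :
  i != j -> `|x 0 i| + `|x 0 j| <= l1norm x.
Proof.
move=> ij; rewrite /l1norm (bigD1 i) //= lerD2l.
by rewrite (bigD1 j) 1?eq_sym //= lerDl sumr_ge0.
Qed.

(** The largest absolute coordinate is at least the average. *)
Lemma exists_large_coord x : (0 < n)%N ->
  exists i, l1norm x <= n%:R * `|x 0 i|.
Proof.
move=> n0; pose i0 : 'I_n := Ordinal n0.
have [i _ imax] := Order.TotalTheory.arg_maxP (P := predT) (i0 := i0)
  (fun i => `|x 0 i|) isT.
exists i; rewrite mulr_natl -[X in _ *+ X](card_ord n) -sumr_const.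
by apply: ler_sum => j _; exact: imax.
Qed.

(** The triangle inequality is applied only off coordinate [i], so the cancellation at [i] is
    kept. *)
Lemma l1normB_cancel x y i :
  l1norm (x - y) <= `|x 0 i - y 0 i| + (l1norm x - `|x 0 i|)
                    + (l1norm y - `|y 0 i|).
Proof.
have l1normD1 z : l1norm z = `|z 0 i| + \sum_(j < n | j != i) `|z 0 j|.
  by rewrite /l1norm (bigD1 i).
have : \sum_(j < n | j != i) `|(x - y) 0 j| <=
    \sum_(j < n | j != i) `|x 0 j| + \sum_(j < n | j != i) `|y 0 j|.
  by rewrite -big_split; apply: ler_sum => j _; rewrite !mxE; exact: ler_normB.
by rewrite !l1normD1 !mxE; lra.
Qed.

Definition signed_vertex (p : 'I_n * bool) : 'rV[R]_n :=
  (-1) ^+ p.2 *: delta_mx 0 p.1.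

Lemma signed_vertexE p j :
  signed_vertex p 0 j = if j == p.1 then (-1) ^+ p.2 else 0.
Proof. by rewrite !mxE /=; case: eqP => _; rewrite ?mulr1 ?mulr0. Qed.

Lemma l1norm_signed_vertex p : l1norm (signed_vertex p) = 1.
Proof.
rewrite /l1norm (bigD1 p.1) //= big1 => [|j /negPf jp]; last first.
  by rewrite signed_vertexE jp normr0.
by rewrite signed_vertexE eqxx normr_sign addr0.
Qed.

Lemma l1norm_signed_vertexB p q :
  p != q -> 2 <= l1norm (signed_vertex p - signed_vertex q).
Proof.
have rowB x y k : (x - y) 0 k = x 0 k - y 0 k by rewrite !mxE.
case: p q => [i b] [j c]; have [<-|ij] := eqVneq i j.
  (* Opposite vertices on one axis: coordinate [i] alone contributes 2. *)
  rewrite xpair_eqE eqxx => /= bc; apply: le_trans (norm_coord_le_l1norm _ i).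
  rewrite rowB !signed_vertexE /= eqxx.
  by case: b c bc => [] [] // _; rewrite expr0 expr1 ler_normr; lra.
(* Different axes: coordinates [i] and [j] contribute 1 each. *)
move=> _; apply: le_trans (norm_coord2_le_l1norm _ ij).
rewrite !rowB !signed_vertexE /= !eqxx.
rewrite [j == i]eq_sym (negPf ij).
by rewrite subr0 sub0r normrN !normr_sign.
Qed.

Definition facet_center : 'rV[R]_n := const_mx n%:R^-1.

Lemma l1norm_facet_center : (0 < n)%N -> l1norm facet_center = 1.
Proof.
move=> n0; rewrite /l1norm (eq_bigr (fun=> n%:R^-1)) => [|i _].
  by rewrite sumr_const card_ord -[LHS]mulr_natl divff // pnatr_eq0 -lt0n.
by rewrite mxE ger0_norm // invr_ge0.
Qed.

Lemma l1norm_signed_vertexB_facet_center p : (0 < n)%N ->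
  2 * (1 - n%:R^-1) <= l1norm (signed_vertex p - facet_center).
Proof.
move=> n0; have := l1norm_facet_center n0.
have v0 : (0 : R) <= n%:R^-1 by rewrite invr_ge0.
rewrite /l1norm (bigD1 p.1) //= [in X in _ -> X](bigD1 p.1) //=.
(* Off [p.1] the vertex vanishes, so these terms sum to [S], which equals 1 - 1/n because the center
   has norm 1. Coordinate [p.1] must supply another 1 - 1/n. *)
rewrite [in X in _ -> X](eq_bigr (fun j => `|facet_center 0 j|)); last first.
  by move=> j /negPf jp; rewrite !mxE eq_sym -(eq_sym j) jp mulr0 sub0r normrN.
move: (\sum_(_ < _ | _) _) => S.
rewrite !mxE !eqxx mulr1 (ger0_norm v0) => vS.
suff : 1 - n%:R^-1 <= `|(-1) ^+ p.2 - n%:R^-1 :> R| by lra.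
by case: p.2; rewrite ?expr1 ?expr0 ler_normr; lra.
Qed.

End L1norm.

(** The index is a classical choice among the large coordinates; a zero coordinate counts as
    nonnegative. *)
Definition sign_class (R : realType) (n : nat) (n0 : (0 < n)%N)
    (x : 'rV[R]_n) : 'I_n * bool :=
  let i := sval (cid (exists_large_coord x n0)) in (i, 0 <= x 0 i).

Lemma sign_class_close (R : realType) (n : nat) (hn : (2 <= n)%N)
    (x y : 'rV[R]_n) : l1norm x <= 1 -> l1norm y <= 1 ->
  sign_class (ltnW hn) x = sign_class (ltnW hn) y ->
  l1norm (x - y) <= 2 * (1 - n%:R^-1).
Proof.
rewrite /sign_class; case: cid => i /= xi; case: cid => j /= yj x1 y1 [ij].
rewrite -{j}ij in yj *.
have n_gt0 : (0 : R) < n%:R by rewrite ltr0n ltnW.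
(* This bound, where [2 <= n] enters, makes 1 - 2/n nonnegative for the final estimate. *)
have v_half : n%:R^-1 <= (2^-1 : R).
  by rewrite lef_pV2 ?posrE // ler_nat.
have v_ge0 : (0 : R) <= n%:R^-1 by rewrite invr_ge0 ltW.
rewrite -ler_pdivrMl // in xi; rewrite -ler_pdivrMl // in yj.
move=> sgn; apply: le_trans (l1normB_cancel _ _ i) _.
have x0 : 0 <= l1norm x by apply: le_trans (norm_coord_le_l1norm x i).
have y0 : 0 <= l1norm y by apply: le_trans (norm_coord_le_l1norm y i).
(* Equal signs at [i] turn the difference of the coordinates into that of their absolute values. *)
have abs_sub : `|x 0 i - y 0 i| = `| `|x 0 i| - `|y 0 i| |.
  move: sgn; case: (ger0P (x 0 i)); case: (ger0P (y 0 i)) => // _ _ _.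
  by rewrite -opprD normrN.
rewrite abs_sub; move: xi yj x1 y1 x0 y0.
move: (l1norm x) (l1norm y) `|x 0 i| `|y 0 i| (n%:R^-1) v_half v_ge0.
move=> s t a b v v2 v0 sa tb s1 t1 s0 t0.
(* The bound is now s + t - 2 min(a, b). If a <= b, then a >= v s gives at most (1 - 2v) s + t <= 2
   - 2v; the other case is symmetric. *)
by case: (lerP a b) => ab; nra.
Qed.

Lemma card_packing_cross_polytope (R : realType) (n : nat) (r : R)
    (D : set 'rV[R]_n) : (2 <= n)%N -> 1 - n%:R^-1 < r ->
  is_packing (cross_polytope R n) r D -> (D #<= `I_(2 * n))%card.
Proof.
move=> hn nr pD.
have -> : (2 * n)%N = #|{: 'I_n * bool}|.
  by rewrite card_prod card_ord card_bool mulnC.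
apply: packing_card_le (sign_class (ltnW hn)) pD _ => x y Kx Ky xy.
by have := sign_class_close Kx Ky xy; lra.
Qed.

Lemma packing_signed_vertex (R : realType) (n : nat) (r : R) :
  0 < r -> r <= 1 ->
  is_packing (cross_polytope R n) r (range (@signed_vertex R n)) /\
  (range (@signed_vertex R n) #= `I_(2 * n))%card.
Proof.
move=> r0 r1.
have -> : (2 * n)%N = #|{: 'I_n * bool}|.
  by rewrite card_prod card_ord card_bool mulnC.
apply: packing_range => // [p|p q pq].
  by rewrite /cross_polytope /= l1norm_signed_vertex.
by have := l1norm_signed_vertexB R pq; lra.
Qed.

Lemma packing_signed_vertex_facet_center (R : realType) (n : nat) (r : R) :
  (0 < n)%N -> 0 < r -> r <= 1 - n%:R^-1 ->
  exists2 D, is_packing (cross_polytope R n) r D & (D #= `I_(2 * n).+1)%card.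
Proof.
move=> n0 r0 rn.
have v0 : (0 : R) <= n%:R^-1 by rewrite invr_ge0.
have -> : (2 * n).+1 = #|{: option ('I_n * bool)}|.
  by rewrite card_option card_prod card_ord card_bool mulnC.
(* [None] indexes the extra point, [Some p] the vertices. *)
pose g p := oapp (@signed_vertex R n) (facet_center R n) p.
suff [] : is_packing (cross_polytope R n) r (range g) /\
    (range g #= `I_#|{: option ('I_n * bool)}|)%card by exists (range g).
apply: packing_range => // [[p|]|].
- by rewrite /cross_polytope /= l1norm_signed_vertex.
- by rewrite /cross_polytope /= l1norm_facet_center.
have symg x y : l1norm (x - y) = l1norm (y - x) :> R.
  by apply: eq_bigr => i _; rewrite !mxE distrC.
move=> [p|] [q|] //= pq.
- by have := l1norm_signed_vertexB R pq; lra.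
- by have := l1norm_signed_vertexB_facet_center R p n0; lra.
- by rewrite symg; have := l1norm_signed_vertexB_facet_center R q n0; lra.
Qed.

Theorem theorem1p1 (R : realType) (n : nat) (hn : (2 <= n)%N) :
  (forall r : R, r \in `]1 - n%:R^-1, 1] ->
     gamma (cross_polytope R n) r = (2 * n)%N) /\
  (forall I : set R, is_interval I -> I `<=` `]0, +oo[ ->
     (forall r : R, I r -> gamma (cross_polytope R n) r = (2 * n)%N) ->
     I `<=` `]1 - n%:R^-1, 1]).
Proof.
have n0 : (0 < n)%N by exact: ltnW.
have n2_gt0 : (0 < 2 * n)%N by rewrite muln_gt0.
split=> [r|I _ I0 gammaI r Ir].
  rewrite in_itv /= => /andP[nr r1]; apply/gamma_eq => //.
  have r0 : 0 < r.
    by apply: le_lt_trans nr; rewrite subr_ge0 invf_le1 ?ltr0n // ler1n.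
  split=> [|D]; last exact: card_packing_cross_polytope.
  have [? ?] := packing_signed_vertex n r0 r1.
  by exists (range (@signed_vertex R n)).
have r0 : 0 < r by have := I0 _ Ir; rewrite /= in_itv /= andbT.
(* Since 2n is positive, it is not the default value 0 of [gamma], so it is an attained maximum. *)
have /gamma_eq -/(_ n2_gt0) [[D [DK Dr] D2n] max2n] := gammaI _ Ir.
rewrite /= in_itv /=; apply/andP; split.
  rewrite ltNge; apply/negP => rn.
  have [D' /max2n D'le D'2n] := packing_signed_vertex_facet_center n0 r0 rn.
  by move: D'le; rewrite (card_le_eql D'2n) card_le_II ltnn.
rewrite leNgt; apply/negP => r1.
(* As 2 < 2r, a single label serves all points, so [D] has at most one point, against its 2n >=
   2. *)
have : (D #<= `I_#|{: unit}|)%card.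
  apply: (packing_card_le (f := fun=> tt)) (conj DK Dr) _ => x y Kx Ky _.
  apply: le_lt_trans (l1normB_le x y) _.
  by move: Kx Ky; rewrite /cross_polytope /=; lra.
rewrite (card_le_eql D2n) card_le_II card_unit leqNgt.
by rewrite (leq_trans _ (leq_mul (leqnn 2) n0)).
Qed.
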